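(* Let $\mathrm{H}$ be a finite group and let $\sigma \in \mathrm{Aut}(\mathrm{H})$ satisfy $\sigma^2 = \mathrm{Id}$. Then there exists an $(\mathrm{H},\sigma)$-graph $\Gamma = (V,E)$ which is connected, nonbipartite, and has exactly $|\mathrm{H}| \cdot (7 + \max(\mathrm{rank}(\mathrm{H}),5))$ vertices. Moreover, every orbit of the action of $\mathrm{Aut}^{\pi}(\Gamma)$ on $V$ consists of exactly $|\mathrm{H}|$ vertices, and the subgraph of $\Gamma$ induced by any such orbit has no edges.
   Context: All graphs are finite, simple and loopless. For a vertex $v$, $N(v)=\{w : (v,w)\in E\}$. A graph is reduced if $N(v)=N(w)$ implies $v=w$. For a reduced graph $\Gamma$, $\mathrm{Aut}^{\pi}(\Gamma)$ (two-fold projections) is the group of bijections $\pi: V\to V$ such that for every $v\in V$ there is $w \in V$ with $\pi(N(v)) = N(w)$. For $\pi \in \mathrm{Aut}^{\pi}(\Gamma)$, $\gamma(\pi)$ is the permutation of $V$ defined by $\gamma(\pi)(v) = w$ where $w$ is the unique vertex with $N(w) = \pi(N(v))$. An $(\mathrm{H},\sigma)$-graph is a reduced graph $\Gamma$ for which there is a group isomorphism $\psi: \mathrm{Aut}^{\pi}(\Gamma) \to \mathrm{H}$ with $\sigma = \psi \circ \gamma \circ \psi^{-1}$. $\mathrm{rank}(\mathrm{H})$ is the minimal cardinality of a generating set of $\mathrm{H}$. *)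

(* Defs.v *)
From HB Require Import structures.
From mathcomp Require Import all_boot all_fingroup all_solvable.

Set Implicit Arguments.
Unset Strict Implicit.
Unset Printing Implicit Defensive.

Import GroupScope.

Record graph := Graph {
  vertex :> finType;
  adj : rel vertex;
  adj_sym : symmetric adj;
  adj_irr : irreflexive adj
}.

Section TwoFold.
Variable G : graph.
Implicit Types (v w : G) (pi : {perm G}).

Definition nbr v : {set G} := [set w | adj v w].

Definition reduced : Prop := injective nbr.

Definition connected : Prop := forall v w, connect (@adj G) v w.

Definition bipartite : Prop :=
  exists A : {set G}, forall v w, adj v w -> (v \in A) != (w \in A).

Definition edgeless (A : {set G}) : Prop :=
  {in A &, forall v w, ~~ adj v w}.

Definition autpi_set : {set {perm G}} :=
  [set pi : {perm G} | [forall v, exists w, pi @: nbr v == nbr w]].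

Lemma autpi_group_set : group_set autpi_set.
Proof.
apply/group_setP; split=> [|s t].
  rewrite inE; apply/forallP=> v; apply/existsP; exists v.
  apply/eqP/setP=> x; apply/imsetP/idP=> [[y yv ->]|xv]; first by rewrite perm1.
  by exists x; rewrite ?perm1.
rewrite !inE => /forallP Hs /forallP Ht; apply/forallP=> v.
have /existsP[w /eqP sv] := Hs v; have /existsP[u /eqP tw] := Ht w.
apply/existsP; exists u; rewrite -tw -sv -imset_comp.
by apply/eqP/eq_imset=> x; rewrite permM.
Qed.

Canonical autpi := Group autpi_group_set.

Definition gamma_fun pi : {ffun G -> G} :=
  [ffun v => odflt v [pick w | nbr w == pi @: nbr v]].

(* The default value 1 is not used when G is reduced and pi is in autpi;
   see gammaP. *)
Definition gamma pi : {perm G} := insubd (1 : {perm G}) (gamma_fun pi).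

Lemma gammaP pi : reduced -> pi \in autpi ->
  forall v w, (gamma pi v == w) = (nbr w == pi @: nbr v).
Proof.
move=> rG; rewrite inE => /forallP Hpi.
have gE v : nbr (gamma_fun pi v) = pi @: nbr v.
  rewrite ffunE; case: pickP => [w /eqP //|no].
  by have /existsP[w] := Hpi v; rewrite eq_sym no.
have gI : injective (gamma_fun pi).
  move=> v w /(congr1 nbr); rewrite !gE => /(imset_inj (@perm_inj _ pi)).
  exact: rG.
have gV v : gamma pi v = gamma_fun pi v.
  have -> : gamma pi v = val (gamma pi) v by rewrite -pvalE.
  by rewrite val_insubd; move/injectiveP: gI => ->.
move=> v w; rewrite gV -gE; apply/eqP/eqP=> [-> //|/rG -> //].
Qed.

End TwoFold.

(* (s * t) x = t (s x) for permutations in MathComp, so autpi carries the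
   opposite of the usual composition law.  Composing psi with inversion passes
   from one law to the other and leaves psi \o gamma \o psi^-1 unchanged. *)
Definition Hsigma_graph (gT : finGroupType) (H : {group gT}) (sigma : {perm gT})
    (G : graph) : Prop :=
  reduced G /\
  exists (psi : {morphism autpi G >-> gT}) (injpsi : 'injm psi),
    psi @* autpi G = H /\
    {in H, forall h, sigma h = psi (gamma (invm injpsi h))}.

(* Main.v *)
Require Import Defs.
From HB Require Import structures.
From mathcomp Require Import all_boot all_fingroup all_solvable.
From mathcomp Require Import zify.

Set Implicit Arguments.
Unset Strict Implicit.
Unset Printing Implicit Defensive.

Import GroupScope.

(* The graph is a voltage graph with vertex set H x I, #|I| = 7 + max(rank H, 5),
   where (a, i) and (b, j) are adjacent iff i and j are adjacent in a base graph
   on I and sigma b = a * voltage i j, with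
   voltage j i = (sigma (voltage i j))^-1.  Left translation by h on the first
   coordinate is then a two-fold projection whose image under gamma is the
   translation by sigma h.

   Conversely, a two-fold projection preserves vertex degrees, which depend only
   on the second coordinate.  The base graph is chosen so that a vertex is
   determined by its degree together with its adjacency to the vertex 2, the
   only one of its degree; hence every two-fold projection preserves the fibres
   H x {i}.  The edges of trivial voltage, which contain the triangle 0, 1, 2,
   force the same permutation f of H on all fibres.  The remaining edges
   1 -- k + 3 carry generators g k of H, so that f commutes with all right
   multiplications and is a left translation. *)

(* The vertices 0, ..., N - 1 form the threshold graph [i + j < N] in which the
   loop at [i], for [2 * i < N], is replaced by an edge to [N] if [i = 2] and to
   [N + 1] otherwise.  This makes their degrees N - i pairwise distinct. *)
Section BaseGraph.
Variable N : nat.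
Implicit Types i j : nat.

Definition base_lt i j : bool :=
  (i < j) &&
  [|| i + j < N, (j == N) && (i == 2)
    | (j == N.+1) && ((i.*2 < N) && (i != 2) || (i == N))].

Definition base i j : bool := base_lt i j || base_lt j i.

(** Vertex [N] is adjacent to 2 and [N.+1] only; [N.+1] is adjacent to [N] and to the [i] other than
    2 with [i.*2 < N]. *)
Definition base_deg i : nat :=
  if i < N then N - i else if i == N then 2 else uphalf N.

Lemma base_sym : symmetric base.
Proof. by move=> i j; rewrite /base orbC. Qed.

Lemma base_irr : irreflexive base.
Proof. by move=> i; rewrite /base /base_lt ltnn. Qed.

Lemma sum_ltn_ord (n k : nat) : \sum_(j < n) (j < k : nat) = minn n k.
Proof.
by elim: n => [|n IHn]; rewrite ?big_ord0 ?big_ord_recr /= ?IHn; lia.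
Qed.

Lemma sum_eq_ord (n k : nat) : \sum_(j < n) (j == k :> nat : nat) = (k < n).
Proof.
by elim: n => [|n IHn]; rewrite ?big_ord0 ?big_ord_recr /= ?IHn; lia.
Qed.

Lemma card_ord2 (p : pred nat) :
  #|[set j : 'I_N.+2 | p j]| = \sum_(j < N) p j + p N + p N.+1.
Proof.
by rewrite cardsE -sum1_card big_mkcond !big_ord_recr /=; congr (_ + _ + _).
Qed.

Hypothesis N_gt9 : 9 < N.

Lemma card_base i : i < N.+2 -> #|[set j : 'I_N.+2 | base i j]| = base_deg i.
Proof.
move=> iN2; rewrite card_ord2.
have [iN | iN] := ltnP i N.
  have E : \sum_(j < N) base i j + (i.*2 < N) = N - i.
    (* Restoring the loop at [i] turns its row into the interval [j < N - i]; when there is no loop,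
       the out-of-range index [N] adds 0. *)
    transitivity (\sum_(j < N) base i j
                  + \sum_(j < N) (j == (if i.*2 < N then i else N) :> nat)).
      by rewrite sum_eq_ord; case: ifP; lia.
    rewrite -big_split /=.
    rewrite (eq_bigr (fun j : 'I_N => nat_of_bool (j < N - i))).
      by rewrite sum_ltn_ord; lia.
    by move=> j _; have := ltn_ord j; rewrite /base /base_lt; case: ifP; lia.
  by move: E; rewrite /base_deg iN /base /base_lt; lia.
have [->|iN'] := eqVneq i N.
  rewrite (eq_bigr (fun j : 'I_N => nat_of_bool (j == 2 :> nat))).
    by rewrite sum_eq_ord /base_deg ltnn eqxx /base /base_lt; lia.
  by move=> j _; have := ltn_ord j; rewrite /base /base_lt; lia.
have -> : i = N.+1 by lia.
have E : \sum_(j < N) base N.+1 j + 1 = uphalf N.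
  (* Adding the omitted index 2 completes the interval [j < uphalf N]. *)
  transitivity (\sum_(j < N) base N.+1 j + \sum_(j < N) (j == 2 :> nat)).
    by rewrite sum_eq_ord; lia.
  rewrite -big_split /= (eq_bigr (fun j : 'I_N => nat_of_bool (j < uphalf N))).
    by rewrite sum_ltn_ord; lia.
  by move=> j _; have := ltn_ord j; rewrite /base /base_lt; lia.
have -> : base_deg N.+1 = uphalf N by rewrite /base_deg; do !case: ifP; lia.
by move: E; rewrite /base /base_lt; lia.
Qed.

Lemma base_deg_eq2 i : i < N.+2 -> base_deg i = base_deg 2 -> i = 2.
Proof. by rewrite /base_deg; do !case: ifP; lia. Qed.

Lemma base_2 i :
  i < N.+2 -> base i 2 = (i != 2) && (i < N - 2) || (i == N).
Proof. by rewrite /base /base_lt; lia. Qed.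

(** The only repeated degrees are those of [N], shared with [N - 2], and of [N.+1], shared with
    [N./2]. Vertex 2 is adjacent to [N] and [N./2] but not to the other two. *)
Lemma base_deg_inj i j : i < N.+2 -> j < N.+2 ->
  base_deg i = base_deg j -> base i 2 = base j 2 -> i = j.
Proof.
by move=> iN jN; rewrite !base_2 // /base_deg; do !case: ifP => ?; lia.
Qed.

Lemma base_neighbor i : i < N.+2 -> exists j : 'I_N.+2, base i j.
Proof.
move=> iN.
have [->|i0] := eqVneq i 0.
  by exists (inord 1); rewrite inordK // /base /base_lt; lia.
have [->|i1] := eqVneq i N.
  by exists (inord 2); rewrite inordK // /base /base_lt; lia.
by exists ord0; rewrite /base /base_lt /=; lia.
Qed.

End BaseGraph.

(** * The voltage graph and its degrees *)

Section VoltageGraph.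
Variables (gT : finGroupType) (s : gT -> gT) (g : nat -> gT) (N : nat).
Hypotheses (sM : {morph s : x y / x * y}) (sK : involutive s).

Local Notation V := (gT * 'I_N.+2)%type.
Implicit Types (v w : V) (i j : 'I_N.+2) (a b : gT).

(** Nontrivial values occur only between 1 and indices above 2; the second branch is forced by
    symmetry of the adjacency. *)
Definition voltage (i j : nat) : gT :=
  if (i == 1%N) && (2 < j) then g (j - 3)
  else if (j == 1%N) && (2 < i) then (s (g (i - 3)))^-1
  else 1.

Definition voltage_adj v w : bool :=
  base N v.2 w.2 && (s w.1 == v.1 * voltage v.2 w.2).

Lemma s1 : s 1 = 1.
Proof. by apply: (mulgI (s 1)); rewrite -sM !mulg1. Qed.

Lemma sV x : s x^-1 = (s x)^-1.
Proof. by apply: (mulgI (s x)); rewrite -sM !mulgV s1. Qed.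

Lemma voltage1 (k : nat) : voltage 1 k.+3 = g k.
Proof. by rewrite /voltage /= !subSS subn0. Qed.

Lemma voltage_sym (i j : nat) : voltage j i = (s (voltage i j))^-1.
Proof.
rewrite /voltage; case: ifP => [/andP[/eqP-> _]|_].
  by rewrite andbF sV sK invgK.
by case: ifP => _ //; rewrite s1 invg1.
Qed.

Lemma voltage_adj_sym : symmetric voltage_adj.
Proof.
suff sub v w : voltage_adj v w -> voltage_adj w v.
  by move=> v w; apply/idP/idP; apply: sub.
rewrite /voltage_adj base_sym => /andP[-> /eqP e] /=.
by rewrite voltage_sym -[w.1]sK e sM mulgK.
Qed.

Lemma voltage_adj_irr : irreflexive voltage_adj.
Proof. by move=> v; rewrite /voltage_adj base_irr. Qed.

Definition voltage_graph : graph := Graph voltage_adj_sym voltage_adj_irr.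
Local Notation G := voltage_graph.

(** As [s] is bijective, there is exactly one neighbour over each base neighbour of [v.2], so
    degrees are those of the base graph. *)
Lemma nbr_voltage v : nbr (v : G) =
  (fun j : 'I_N.+2 => (s (v.1 * voltage v.2 j), j))
    @: [set j : 'I_N.+2 | base N v.2 j].
Proof.
apply/setP=> w; rewrite inE; apply/idP/imsetP => [/andP[vw /eqP e]|[j]].
  by exists w.2; rewrite ?inE // -e sK -surjective_pairing.
by rewrite inE => vj ->; rewrite /= /voltage_adj /= vj sK eqxx.
Qed.

Lemma voltage_base_nbr v (k : nat) : k < N.+2 ->
  base N v.2 k = [exists w : V, voltage_adj v w && (w.2 == k :> nat)].
Proof.
move=> kN; apply/idP/existsP => [vk|[w /andP[/andP[vw _] /eqP <-]] //].
exists (s (v.1 * voltage v.2 k), Ordinal kN).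
by rewrite /voltage_adj /= vk sK !eqxx.
Qed.

Hypothesis N_gt9 : 9 < N.

Lemma card_nbr_voltage v : #|nbr (v : G)| = base_deg N v.2.
Proof.
rewrite nbr_voltage card_imset ?card_base // => j k [].
by move=> _ ->.
Qed.

Lemma voltage_reduced : reduced G.
Proof.
move=> v w e.
have adjE x : voltage_adj v x = voltage_adj w x.
  by move/setP/(_ x): e; rewrite !inE.
have i_eq : v.2 = w.2 :> nat.
  apply: (base_deg_inj N_gt9); rewrite ?ltn_ord //.
    by rewrite -!card_nbr_voltage e.
  rewrite !voltage_base_nbr; try lia.
  by apply: eq_existsb => x; rewrite adjE.
have [j vj] := base_neighbor N_gt9 (ltn_ord v.2).
have := adjE (s (v.1 * voltage v.2 j), j).
rewrite /voltage_adj /= vj -i_eq vj sK eqxx /= => /esym/eqP/mulIg.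
by move/val_inj: i_eq; case: (v) (w) => [a i] [b k] /= -> ->.
Qed.

(** * Left translations as two-fold projections *)

Definition translate_fun (h : gT) v : V := (h * v.1, v.2).

Lemma translate_inj h : injective (translate_fun h).
Proof. by move=> [a i] [b j] [/mulgI-> ->]. Qed.

Definition translate h : {perm G} := perm (@translate_inj h).

Lemma translateE h v : translate h v = (h * v.1, v.2).
Proof. by rewrite permE. Qed.

Lemma translate_adj h v w :
  voltage_adj (translate (s h) v) (translate h w) = voltage_adj v w.
Proof.
by rewrite !translateE /voltage_adj /= sM -mulgA (inj_eq (mulgI _)).
Qed.

Lemma nbr_translate h (v : G) :
  translate h @: nbr v = nbr (translate (s h) v : G).
Proof.
apply/setP=> w; have [w' ->] : exists w', w = translate h w'.
  by exists ((translate h)^-1 w); rewrite permKV.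
by rewrite (mem_imset _ _ perm_inj) !inE /= translate_adj.
Qed.

Lemma translate_autpi h : translate h \in autpi G.
Proof.
rewrite inE; apply/forallP=> v; apply/existsP; exists (translate (s h) v).
by rewrite nbr_translate.
Qed.

Lemma gamma_translate h : gamma (translate h) = translate (s h).
Proof.
apply/permP=> v; apply/eqP.
by rewrite (gammaP voltage_reduced (translate_autpi h)) nbr_translate.
Qed.

(** * Rigidity of two-fold projections *)

Lemma twofold_color (p q : {perm G}) :
    (forall v w, voltage_adj (p v) (q w) = voltage_adj v w) ->
  forall v, (p v).2 = v.2.
Proof.
move=> pq.
have degE (p' q' : {perm G}) :
    (forall v w, voltage_adj (p' v) (q' w) = voltage_adj v w) ->
  forall v, base_deg N (p' v).2 = base_deg N v.2.
  move=> pq' v; rewrite -!card_nbr_voltage.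
  rewrite -[RHS](card_imset _ (@perm_inj _ q')).
  apply: eq_card => w; have [w' ->] : exists w', w = q' w'.
    by exists (q'^-1 w); rewrite permKV.
  rewrite (mem_imset _ _ perm_inj) !inE; exact: pq'.
(* Swapping roles shows that [q] also preserves degrees, hence the fibre over 2; [p] then preserves
   adjacency to that fibre. *)
have qp v w : voltage_adj (q v) (p w) = voltage_adj v w.
  by rewrite voltage_adj_sym pq voltage_adj_sym.
have q2 w : ((q w).2 == 2 :> nat) = (w.2 == 2 :> nat).
  have d := degE _ _ qp w.
  by apply/eqP/eqP => e; apply: (base_deg_eq2 N_gt9 (ltn_ord _));
    rewrite -?d ?e // d e.
move=> v; apply/val_inj/(base_deg_inj N_gt9); rewrite ?ltn_ord ?(degE p q) //.
rewrite !voltage_base_nbr; try lia.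
apply/existsP/existsP => [] [w].
  move=> vw; exists (q^-1 w); rewrite -pq -q2 permKV //.
by move=> vw; exists (q w); rewrite pq q2.
Qed.

Hypothesis g_gen : <<[set g k | k : 'I_(N - 4)]>> = [set: gT].

(** In a finite group every element is a product of generators, without inverses. *)
Lemma gen_stable (P : pred gT) :
    P 1 -> (forall x k, k < N - 4 -> P x -> P (x * g k)) -> forall x, P x.
Proof.
move=> P1 PM x; have : x \in <<[set g k | k : 'I_(N - 4)]>>.
  by rewrite g_gen inE.
case/gen_prodgP=> n [c cA ->]; elim: n c cA => [|n IHn] c cA.
  by rewrite big_ord0.
rewrite big_ord_recr /=; have /imsetP[k _ ->] := cA ord_max.
by apply: PM => //; apply: IHn.
Qed.

Lemma twofold_translate (p q : {perm G}) :
    (forall v w, voltage_adj (p v) (q w) = voltage_adj v w) ->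
  exists h, p = translate h.
Proof.
move=> pq.
have qp v w : voltage_adj (q v) (p w) = voltage_adj v w.
  by rewrite voltage_adj_sym pq voltage_adj_sym.
pose f (i : nat) a := (p (a, inord i)).1.
(* The twist by [s] makes the condition on an edge free of [s]. *)
pose e (j : nat) a := s (q (s a, inord j)).1.
have edge (i j : nat) a : i < N.+2 -> j < N.+2 -> base N i j ->
  e j (a * voltage i j) = f i a * voltage i j.
  move=> iN jN ij; have := pq (a, inord i) (s (a * voltage i j), inord j).
  rewrite /voltage_adj !(twofold_color pq) !(twofold_color qp) /=.
  by rewrite !inordK // ij sK eqxx => /eqP.
have edge1 (i j : nat) a : i < N.+2 -> j < N.+2 -> base N i j ->
  i != 1%N \/ j <= 2 -> j != 1%N \/ i <= 2 -> e j a = f i a.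
  move=> iN jN ij i1 j1; have := edge i j a iN jN ij.
  have -> : voltage i j = 1.
    by rewrite /voltage; do 2?case: ifP => //; lia.
  by rewrite !mulg1.
have f0 (i : nat) a : i < N.+2 -> f i a = f 0 a.
  (* The odd cycle 0, 1, 2 links [e 0] to [f 0]. Vertex 0 then reaches every other vertex but [N],
     which is reached through [N.+1]. *)
  have e1 : e 1%N a = f 0 a by apply: edge1; rewrite /base /base_lt; lia.
  have e2 : e 2 a = f 0 a by apply: edge1; rewrite /base /base_lt; lia.
  have f1 : f 1%N a = f 0 a.
    by rewrite -e2; apply/esym/edge1; rewrite /base /base_lt; lia.
  have e0 : e 0 a = f 0 a.
    by rewrite -f1; apply: edge1; rewrite /base /base_lt; lia.
  have eN : e N.+1 a = f 0 a by apply: edge1; rewrite /base /base_lt; lia.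
  move=> iN; have [-> //|i0] := posnP i.
  have [->|iN'] := eqVneq i N.
    by rewrite -eN; apply/esym/edge1; rewrite /base /base_lt; lia.
  by rewrite -e0; apply/esym/edge1; rewrite /base /base_lt; lia.
have e0 (j : nat) a : 2 < j < N -> e j a = f 0 a.
  by move=> jN; apply: edge1; rewrite /base /base_lt; lia.
have fM a x : f 0 (a * x) = f 0 a * x.
  apply/eqP; move: x; apply: gen_stable => [|x k kN /eqP fx].
    by rewrite !mulg1.
  (* The bound [k < N - 4] is exactly the condition for 1 and [k.+3] to be adjacent. *)
  have := edge 1%N k.+3 (a * x); rewrite voltage1 e0 ?f0; try lia.
  rewrite !mulgA -fx => ->; try lia; first by [].
  by rewrite /base /base_lt; lia.
exists (f 0 1); apply/permP=> v; rewrite translateE -fM mul1g.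
rewrite -(f0 v.2) // -(twofold_color pq v) [LHS]surjective_pairing.
by rewrite /f inord_val (twofold_color pq) -surjective_pairing.
Qed.

Lemma autpi_voltageP (p : {perm G}) :
  reflect (exists h, p = translate h) (p \in autpi G).
Proof.
apply: (iffP idP) => [pG|[h ->]]; last exact: translate_autpi.
(* The pair [p], [gamma p] preserves adjacency because [nbr (gamma p w)] is the image of [nbr w]
   under [p]. *)
apply: (@twofold_translate _ (gamma p)) => v w.
have /(_ w (gamma p w))/esym := gammaP voltage_reduced pG.
rewrite eqxx => /eqP/setP/(_ (p v)).
rewrite (mem_imset _ _ perm_inj) !inE /= => e.
by rewrite voltage_adj_sym e voltage_adj_sym.
Qed.

Lemma orbit_voltage (v : G) :
  orbit 'P (autpi G) v = [set (a, v.2) | a : gT].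
Proof.
apply/setP=> w; apply/orbitP/imsetP=> [[p /autpi_voltageP[h ->] <-]|[a _ ->]].
  by exists (h * v.1); rewrite //= apermE translateE.
exists (translate (a * v.1^-1)); first exact: translate_autpi.
by rewrite /= apermE translateE mulgKV.
Qed.

(** * Connectedness and nonbipartiteness *)

Lemma voltage_connected : connected G.
Proof.
have csym : connect_sym (@adj G) by apply: sym_connect_sym voltage_adj_sym.
have step (i j : nat) a : i < N.+2 -> j < N.+2 -> base N i j ->
  connect (@adj G) (a, inord i) (s (a * voltage i j), inord j).
  move=> iN jN ij; apply: connect1.
  by rewrite /= /voltage_adj /= !inordK // ij sK eqxx.
have step1 (i j : nat) a : i < N.+2 -> j < N.+2 -> base N i j ->
  i != 1%N \/ j <= 2 -> j != 1%N \/ i <= 2 ->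
  connect (@adj G) (a, inord i) (s a, inord j).
  move=> iN jN ij i1 j1; have := step i j a iN jN ij.
  have -> : voltage i j = 1.
    by rewrite /voltage; do 2?case: ifP => //; lia.
  by rewrite !mulg1.
have c1 a : connect (@adj G) (a, inord 0) (s a, inord 1).
  by apply: step1; rewrite /base /base_lt; lia.
have c2 a : connect (@adj G) (a, inord 2) (s a, inord 0).
  by apply: step1; rewrite /base /base_lt; lia.
have c12 a : connect (@adj G) (a, inord 1) (s a, inord 2).
  by apply: step1; rewrite /base /base_lt; lia.
(* The triangle 0, 1, 2 is an odd closed walk of trivial voltage. *)
have cs a : connect (@adj G) (a, inord 0) (s a, inord 0).
  have := connect_trans (c1 a) (connect_trans (c12 _) (c2 _)).
  by rewrite sK.
have c0 (i : nat) a : i < N.+2 -> connect (@adj G) (a, inord i) (a, inord 0).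
  have ci (j : nat) : 0 < j < N \/ j = N.+1 ->
    connect (@adj G) (a, inord j) (a, inord 0).
    move=> jN; apply: connect_trans (_ : connect _ _ (s a, inord 0)) _.
      by apply: step1; rewrite /base /base_lt; lia.
    by rewrite -{2}[a]sK; apply: cs.
  move=> iN; have [-> //|i0] := posnP i; have [->|iN'] := eqVneq i N.
    apply: connect_trans (_ : connect _ _ (s a, inord 2)) _.
      by apply: step1; rewrite /base /base_lt; lia.
    by have := c2 (s a); rewrite sK.
  by apply: ci; lia.
have cg x : connect (@adj G) (1, inord 0) (x, inord 0).
  move: x; apply: gen_stable => // x k kN cx.
  (* Pass from fibre 0 to fibre 1 at [x], cross the edge carrying [g k], return to fibre 0 and undo
     [s] by [cs]. *)
  apply: connect_trans cx _; rewrite csym.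
  apply: connect_trans (cs _) _.
  apply: connect_trans (_ : connect _ _ (s (x * g k), inord k.+3)) _.
    by rewrite csym; apply: c0; lia.
  rewrite csym; apply: connect_trans (_ : connect _ _ (x, inord 1)) _.
    by rewrite csym; apply: c0.
  have := step 1%N k.+3 x; rewrite voltage1; apply=> //.
    by lia.
  by rewrite /base /base_lt; lia.
have all0 v : connect (@adj G) (1, inord 0) v.
  rewrite csym; case: v => a i; have := c0 i a (ltn_ord i).
  by rewrite inord_val => /connect_trans; apply; rewrite csym.
by move=> v w; apply: connect_trans (all0 w); rewrite csym.
Qed.

Lemma voltage_nonbipartite : ~ bipartite G.
Proof.
(* Since [s] fixes 1, the base triangle 0, 1, 2 lifts to a triangle. *)
pose v (i : nat) : G := (1, inord i).
case=> A AG.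
have edge (i j : nat) : i < 3 -> j < 3 -> i != j -> (v i \in A) != (v j \in A).
  move=> i3 j3 ij; apply: AG; rewrite /= /voltage_adj /= !inordK; try lia.
  rewrite s1 mul1g /voltage !ifF; try lia.
  by rewrite eqxx /base /base_lt; lia.
have := edge 0 1%N isT isT isT; have := edge 0 2 isT isT isT.
have := edge 1%N 2 isT isT isT.
by do 3!case: (_ \in A).
Qed.

End VoltageGraph.

Theorem theorem5p13 (gT : finGroupType) (H : {group gT}) (sigma : {perm gT})
    (sigmaAut : sigma \in Aut H) (sigma2 : sigma ^+ 2 = 1) :
  exists G : graph,
    [/\ Hsigma_graph H sigma G,
        connected G,
        ~ bipartite G,
        #|G| = (#|H| * (7 + maxn 'm(H) 5))%N
      & forall v : G,
          #|orbit 'P (autpi G) v| = #|H| /\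
          edgeless (orbit 'P (autpi G) v)].
Proof.
pose hT := subg_of H.
pose s (x : hT) : hT := subg H (sigma (sgval x)).
have sigmaH x : x \in H -> sigma x \in H by apply: Aut_closed.
have sE x : sgval (s x) = sigma (sgval x).
  by rewrite /s subgK ?sigmaH ?subgP.
have sM : {morph s : x y / x * y}.
  move=> x y; apply: val_inj; rewrite /= sE !sgvalM ?inE // !sE.
  by rewrite -!(autmE sigmaAut) morphM ?subgP.
have sK : involutive s.
  by move=> x; apply: val_inj; rewrite /= !sE -permM -expg2 sigma2 perm1.
have [B genB cardB] := grank_witness H.
have BH : B \subset H by rewrite -genB subset_gen.
(* This gives [N.+2] fibres and [N - 4] generator edges, more than the rank of [H]. *)
pose N := 5 + maxn 'm(H) 5.
have N_gt9 : 9 < N by rewrite /N; lia.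
(* The default 1 fills the generator slots beyond the rank. *)
pose g (k : nat) : hT := subg H (nth 1 (enum B) k).
have g_gen : <<[set g k | k : 'I_(N - 4)]>> = [set: hT].
  have H_gen : sgval @* [set: hT] = <<sgval @* [set g k | k : 'I_(N - 4)]>>.
    apply/eqP; rewrite eqEsubset; apply/andP; split.
      rewrite im_sgval -genB gen_subG; apply/subsetP=> x xB.
      apply: mem_gen; apply/morphimP.
      have kN : index x (enum B) < N - 4.
        have : index x (enum B) < size (enum B) by rewrite index_mem mem_enum.
        by rewrite -cardE cardB /N; lia.
      exists (g (Ordinal kN)); rewrite ?inE //; first exact: imset_f.
      by rewrite /g /= nth_index ?mem_enum // subgK // (subsetP BH).
    by rewrite gen_subG morphimS ?subsetT.
  apply: (injm_morphim_inj (injm_sgval H)); rewrite ?subsetT //.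
  by rewrite H_gen morphim_gen ?subsetT.
pose G := voltage_graph g N sM sK.
have redG : reduced G := voltage_reduced N_gt9.
have autP := @autpi_voltageP _ s g N sM sK N_gt9 g_gen.
have card_hT : #|{: hT}| = #|H| by rewrite -cardsT -(card_isog (isog_subg H)).
(* Permutation products apply the left factor first, so translations compose in reverse order; the
   inverse corrects this. *)
pose psi (p : {perm G}) : gT := sgval (p (1, ord0)).1^-1.
have psiE h : psi (translate g N sM sK h) = sgval h^-1.
  by rewrite /psi translateE mulg1.
have psiM : {in autpi G &, {morph psi : p q / p * q}}.
  move=> p q /autP[h ->] /autP[k ->].
  by rewrite /psi permM !translateE /= !mulg1 invMg.
pose psiF := Morphism psiM.
have injpsi : 'injm psiF.
  apply/injmP=> p q /autP[h ->] /autP[k ->].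
  by rewrite /= !psiE => /val_inj/invg_inj ->.
exists G; split.
- split=> //; exists psiF, injpsi; split.
    apply/setP=> x; apply/morphimP/idP => [[p _ /autP[h ->] ->]|xH].
      by rewrite /= psiE subgP.
    exists (translate g N sM sK (subg H x)^-1); try exact: translate_autpi.
    by rewrite /= psiE invgK subgK.
  move=> h hH; pose p := translate g N sM sK (subg H h)^-1.
  have pE : psi p = h by rewrite psiE invgK subgK.
  rewrite -{2}pE invmE ?translate_autpi // gamma_translate //= psiE.
  by rewrite -sV // invgK sE subgK.
- exact: voltage_connected.
- exact: voltage_nonbipartite.
- by rewrite card_prod card_ord card_hT /N; lia.
move=> v; rewrite orbit_voltage //; split.
  by rewrite card_imset ?card_hT // => a b [].
move=> _ _ /imsetP[a _ ->] /imsetP[b _ ->].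
by rewrite /= /voltage_adj /= base_irr.
Qed.
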